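(* Let $T=(n;\delta,\sigma)$ with $\delta,\sigma\in\mathbb{R}$, $\sigma\neq 0$. The equality $$d_2^{\mathcal{T}}(T)=\frac{1}{\|T^{-1}\|_2}$$ holds true if and only if $T$ is positive or negative definite. In more detail, if $T$ is positive or negative definite and $\lambda_k$ (with either $k=1$ or $k=n$) is its eigenvalue of smallest magnitude, then $$d_2(T)=d_2^{\mathcal{T}}(T)=|\lambda_k|=d_F(T)<d_F^{\mathcal{T}}(T)=\frac{|\lambda_k|}{\kappa^{\mathcal{T}}(\lambda_k)}.$$ Thus, in such a case, the reciprocal of the spectral condition number of $T$ is equal to its relative structured distance to the closest singular matrix with respect to the spectral norm: $$\frac{1}{\kappa_2(T)}=\min_{\Delta T\in\mathcal{T}}\left\{\frac{\|\Delta T\|_2}{\|T\|_2} : T+\Delta T\in\mathcal{S}\right\}.$$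
   Context: $(n;d,s)$ denotes the $n\times n$ real symmetric tridiagonal Toeplitz matrix with all diagonal entries equal to $d$ and all sub- and superdiagonal entries equal to $s$. $\mathcal{T}\subset\mathbb{R}^{n\times n}$ is the linear subspace of all such matrices ($d,s\in\mathbb{R}$), and $\mathcal{S}\subset\mathbb{R}^{n\times n}$ is the set of singular matrices. The eigenvalues of $T=(n;\delta,\sigma)$ are $\lambda_h=\delta+2\sigma\cos\frac{h\pi}{n+1}$, $h=1,\dots,n$. $\|\cdot\|_2$ is the spectral norm, $\|\cdot\|_F$ the Frobenius norm, and $\kappa_2(T)=\|T\|_2\|T^{-1}\|_2$ is the spectral condition number. The unstructured distances to singularity are $d_2(T)=\min_{S\in\mathcal{S}}\|T-S\|_2$ and $d_F(T)=\min_{S\in\mathcal{S}}\|T-S\|_F$; the structured distances to singularity are $d_2^{\mathcal{T}}(T)=\min_{S\in\mathcal{S}\cap\mathcal{T}}\|T-S\|_2$ and $d_F^{\mathcal{T}}(T)=\min_{S\in\mathcal{S}\cap\mathcal{T}}\|T-S\|_F$. The structured condition number of $\lambda_h$ is $\kappa^{\mathcal{T}}(\lambda_h)=\max_{E\in\mathcal{T},\,\|E\|_F=1}|\mathbf{x}_h^TE\mathbf{x}_h|=\sqrt{\frac1n+\frac{2}{n-1}\cos^2\frac{h\pi}{n+1}}$, where $\mathbf{x}_h$ is a unit-norm eigenvector of $T$ for $\lambda_h$.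
   Formalization: The false ''only if'' (it fails for (2;0,1)) is replaced by: the equality holds for every nonsingular T. The strict inequality d_F < d_F^T is claimed only for n ≥ 3, as equality holds for n = 2. n ≥ 2 is assumed throughout. *)

(* Defs.v *)
From HB Require Import structures.
From mathcomp Require Import all_boot all_order all_algebra.
From mathcomp Require Import all_classical all_reals all_analysis.

Set Implicit Arguments.
Unset Strict Implicit.
Unset Printing Implicit Defensive.

Import Order.TTheory GRing.Theory Num.Theory.
Local Open Scope classical_set_scope.
Local Open Scope ring_scope.

(* The default value 0 is returned when the extremum is not attained.  Hence an
   equation [minval E = c] or [maxval E = c] with [c != 0] also asserts that
   the extremum is attained. *)
Definition minval (R : realType) (E : set R) : R := xget 0 (E `&` lbound E).
Definition maxval (R : realType) (E : set R) : R := xget 0 (E `&` ubound E).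

(* On column vectors (n = 1) this is the Euclidean norm.  It is needed because
   the library norm on matrices is the maximum norm. *)
Definition frobenius (R : realType) (m n : nat) (A : 'M[R]_(m, n)) : R :=
  Num.sqrt (\sum_(i < m) \sum_(j < n) A i j ^+ 2).

Definition spectral (R : realType) (n : nat) (A : 'M[R]_n) : R :=
  sup [set frobenius (A *m x) | x in [set x : 'cV[R]_n | frobenius x = 1]].

Definition cond2 (R : realType) (n : nat) (A : 'M[R]_n) : R :=
  spectral A * spectral (invmx A).

Definition tridiag (R : realType) (n : nat) (d s : R) : 'M[R]_n :=
  \matrix_(i < n, j < n)
    if i == j then d
    else if (i.+1 == j :> nat) || (j.+1 == i :> nat) then s
    else 0.

Definition toeplitz3 (R : realType) (n : nat) : set 'M[R]_n :=
  [set A | exists d s : R, A = tridiag n d s].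

Definition singular (R : realType) (n : nat) : set 'M[R]_n :=
  [set A | A \notin unitmx].

Definition dist (R : realType) (n : nat) (N : 'M[R]_n -> R) (C : set 'M[R]_n)
    (A : 'M[R]_n) : R :=
  minval [set N (A - S) | S in C].

Definition d2 (R : realType) (n : nat) (A : 'M[R]_n) : R :=
  dist (@spectral R n) (@singular R n) A.

Definition dF (R : realType) (n : nat) (A : 'M[R]_n) : R :=
  dist (@frobenius R n n) (@singular R n) A.

Definition d2T (R : realType) (n : nat) (A : 'M[R]_n) : R :=
  dist (@spectral R n) (@singular R n `&` @toeplitz3 R n) A.

Definition dFT (R : realType) (n : nat) (A : 'M[R]_n) : R :=
  dist (@frobenius R n n) (@singular R n `&` @toeplitz3 R n) A.

Definition quadform (R : realType) (n : nat) (A : 'M[R]_n) (x : 'cV[R]_n) : R :=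
  (x^T *m A *m x) 0 0.

Definition posdef (R : realType) (n : nat) (A : 'M[R]_n) : Prop :=
  forall x : 'cV[R]_n, x != 0 -> 0 < quadform A x.

Definition negdef (R : realType) (n : nat) (A : 'M[R]_n) : Prop :=
  forall x : 'cV[R]_n, x != 0 -> quadform A x < 0.

(* The eigenvalues of [tridiag n d s] are the [eigval n d s h], 1 <= h <= n. *)
Definition eigval (R : realType) (n : nat) (d s : R) (h : nat) : R :=
  d + 2 * s * cos (h%:R * pi / n.+1%:R).

Definition unit_eigenvector (R : realType) (n : nat) (A : 'M[R]_n) (l : R)
    (x : 'cV[R]_n) : Prop :=
  A *m x = l *: x /\ frobenius x = 1.

(* Structured condition number of the eigenvalue having x as a unit
   eigenvector. *)
Definition kappaT (R : realType) (n : nat) (x : 'cV[R]_n) : R :=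
  maxval [set `|quadform E x| |
            E in @toeplitz3 R n `&` [set E | frobenius E = 1]].

(* Main.v *)
Require Import Defs.
From HB Require Import structures.
From mathcomp Require Import all_boot all_order all_algebra.
From mathcomp Require Import all_classical all_reals all_analysis.
From mathcomp Require Import zify ring lra.

Import Order.TTheory GRing.Theory Num.Theory.
Local Open Scope classical_set_scope.
Local Open Scope ring_scope.

(** The matrices [tridiag n d s] with n fixed commute: the discrete sine vectors
    form one orthonormal eigenbasis for all of them, and the eigenvalue of index
    h is the linear form d + 2 s cos (h pi / (n + 1)) in (d, s).  Everything
    follows from this.

    For T in the family and k the index of an eigenvalue l of least modulus,
    expansion in the eigenbasis ([tridiag_ge]) shows that T maps every unit
    vector to a vector of norm at least |l|.  A singular S has a unit kernel
    vector, on which T - S agrees with T; so T - S has spectral norm, and a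
    fortiori Frobenius norm, at least |l|.  The spectral bound is attained at
    T - l I, which is again in the family ([dist_spectral_shift]), and the
    Frobenius bound at the rank-one deflation of an eigenvector
    ([dF_deflation]).  The same lower bound gives the norm 1 / |l| for the
    inverse of T ([spectral_invmx]).  The formula for the reciprocal of the
    condition number is the spectral one divided by the norm of T.

    The structured Frobenius distance is a problem in the two variables (d, s).
    The square Frobenius norm n d^2 + 2 (n - 1) s^2 is a weighted Euclidean
    norm on them, for which the linear form eigenvalue of index h has norm
    kappa_h, with kappa_h^2 = 1 / n + 2 / (n - 1) cos^2 (h pi / (n + 1)); by
    Cauchy--Schwarz this is the structured condition number ([kappaTE]), and
    annihilating the eigenvalue of index h costs exactly |lambda_h| / kappa_h.
    When T is definite its eigenvalues have one sign and are strictly monotone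
    in the index, so that only k = 1 or k = n can have least modulus
    ([definite_smallest]); these two indices also have the greatest condition
    number ([kappa_sqr_le], [kappa_sqr_last]).  Hence the minimum over h of
    |lambda_h| / kappa_h is reached at h = k ([dFT_eigval]).  It exceeds |l| for
    n > 2 because then kappa_k < 1 ([kappa_sqr_lt1]). *)

(** * Attained extrema *)

Lemma minvalE {R : realType} {E : set R} {c : R} :
  E c -> lbound E c -> minval E = c.
Proof.
move=> Ec lbc; apply: xget_unique => // y [Ey lby].
by apply/le_anti; rewrite lbc // lby.
Qed.

Lemma maxvalE {R : realType} {E : set R} {c : R} :
  E c -> ubound E c -> maxval E = c.
Proof.
move=> Ec ubc; apply: xget_unique => // y [Ey uby].
by apply/le_anti; rewrite ubc // uby.
Qed.

(** * Frobenius and spectral norms *)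

Lemma frobenius_ge0 {R : realType} {m n : nat} (A : 'M[R]_(m, n)) :
  0 <= frobenius A.
Proof. exact: sqrtr_ge0. Qed.

Lemma frobenius_sqr {R : realType} {m n : nat} (A : 'M[R]_(m, n)) :
  frobenius A ^+ 2 = \sum_(i < m) \sum_(j < n) A i j ^+ 2.
Proof.
rewrite sqr_sqrtr //; apply: sumr_ge0 => i _; apply: sumr_ge0 => j _.
exact: sqr_ge0.
Qed.

Lemma frobenius_tr {R : realType} {m n : nat} (A : 'M[R]_(m, n)) :
  frobenius A ^+ 2 = \tr (A^T *m A).
Proof.
rewrite frobenius_sqr exchange_big /=; apply: eq_bigr => j _.
by rewrite mxE; apply: eq_bigr => i _; rewrite !mxE expr2.
Qed.

Lemma frobenius_dot {R : realType} {n : nat} (x : 'cV[R]_n) :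
  frobenius x ^+ 2 = (x^T *m x) 0 0.
Proof. by rewrite frobenius_tr /mxtrace big_ord1. Qed.

Lemma frobeniusZ {R : realType} {m n : nat} (a : R) (A : 'M[R]_(m, n)) :
  frobenius (a *: A) = `|a| * frobenius A.
Proof.
apply/eqP; rewrite -(@eqrXn2 _ 2) ?mulr_ge0 ?frobenius_ge0 //.
rewrite exprMn real_normK ?num_real // !frobenius_sqr mulr_sumr; apply/eqP.
apply: eq_bigr => i _; rewrite mulr_sumr; apply: eq_bigr => j _.
by rewrite mxE exprMn.
Qed.

Lemma frobenius0 {R : realType} {m n : nat} :
  frobenius (0 : 'M[R]_(m, n)) = 0.
Proof. by rewrite -(scale0r (0 : 'M[R]_(m, n))) frobeniusZ normr0 mul0r. Qed.

Lemma frobenius_eq0 {R : realType} {m n : nat} (A : 'M[R]_(m, n)) :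
  (frobenius A == 0) = (A == 0).
Proof.
apply/idP/eqP => [|->]; last by rewrite frobenius0.
rewrite -sqrf_eq0 frobenius_sqr psumr_eq0 => [/allP A0|i _]; last first.
  by apply: sumr_ge0 => j _; exact: sqr_ge0.
apply/matrixP => i j; rewrite mxE; apply/eqP; rewrite -sqrf_eq0.
have := A0 i (mem_index_enum i); rewrite psumr_eq0 => [/allP Ai0|k _].
  exact: (Ai0 j (mem_index_enum j)).
exact: sqr_ge0.
Qed.

Lemma frobenius_isometry {R : realType} {m n p : nat}
    (U : 'M[R]_(m, n)) (A : 'M[R]_(n, p)) :
  U^T *m U = 1%:M -> frobenius (U *m A) = frobenius A.
Proof.
move=> UU; apply/eqP; rewrite -(@eqrXn2 _ 2) ?frobenius_ge0 //.
by rewrite !frobenius_tr trmx_mul mulmxA -(mulmxA A^T) UU mulmx1.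
Qed.

(** Expanding the nonnegative sum of the squares of B a_i - C b_i, with
    B the square norm of b and C the inner product, gives B (A B - C^2). *)
Lemma sum_mul_sqr_le {R : realType} {n : nat} (a b : 'I_n -> R) :
  (\sum_i a i * b i) ^+ 2 <= (\sum_i a i ^+ 2) * (\sum_i b i ^+ 2).
Proof.
set C := \sum_i a i * b i; set A := \sum_i a i ^+ 2; set B := \sum_i b i ^+ 2.
have B0 : 0 <= B by apply: sumr_ge0 => i _; exact: sqr_ge0.
have : 0 <= \sum_i (B * a i - C * b i) ^+ 2.
  by apply: sumr_ge0 => i _; exact: sqr_ge0.
have -> : \sum_i (B * a i - C * b i) ^+ 2 = B * (A * B - C ^+ 2).
  under eq_bigr => i _.
    have -> : (B * a i - C * b i) ^+ 2 =
      B ^+ 2 * a i ^+ 2 - 2 * B * C * (a i * b i) + C ^+ 2 * b i ^+ 2 by ring.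
    over.
  by rewrite big_split sumrB /= -!mulr_sumr -/A -/B -/C; ring.
move: B0; rewrite le_eqVlt => /predU1P[B0|B0]; last first.
  by rewrite pmulr_rge0 // subr_ge0.
move=> _; rewrite -B0 mulr0 /C big1 ?expr0n // => i _.
suff /eqP -> : b i == 0 by rewrite mulr0.
have /esym/eqP := B0; rewrite psumr_eq0 => [/allP b0|j _]; last exact: sqr_ge0.
by rewrite -sqrf_eq0; exact: b0 (mem_index_enum i).
Qed.

Lemma frobenius_mulmx_le {R : realType} {m n : nat}
    (A : 'M[R]_(m, n)) (x : 'cV[R]_n) :
  frobenius (A *m x) <= frobenius A * frobenius x.
Proof.
rewrite -(@ler_pXn2r _ 2) ?nnegrE ?mulr_ge0 ?frobenius_ge0 //.
rewrite exprMn !frobenius_sqr mulr_suml; apply: ler_sum => i _.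
rewrite big_ord1 mxE; under [X in _ <= _ * X]eq_bigr do rewrite big_ord1.
exact: sum_mul_sqr_le.
Qed.

Lemma spectral_ge {R : realType} {n : nat} (A : 'M[R]_n) (x : 'cV[R]_n) :
  frobenius x = 1 -> frobenius (A *m x) <= spectral A.
Proof.
move=> x1; apply: ub_le_sup; last by exists x.
exists (frobenius A) => _ [y /= y1 <-].
by rewrite -[leRHS]mulr1 -y1; exact: frobenius_mulmx_le.
Qed.

Lemma spectralE {R : realType} {n : nat} {A : 'M[R]_n} {c : R} {x : 'cV[R]_n} :
  frobenius x = 1 -> frobenius (A *m x) = c ->
  (forall y : 'cV[R]_n, frobenius y = 1 -> frobenius (A *m y) <= c) ->
  spectral A = c.
Proof.
move=> x1 Axc Ac; apply/le_anti/andP; split; last by rewrite -Axc spectral_ge.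
by apply: ge_sup => [|_ [y /= y1 <-]]; [exists c, x | exact: Ac].
Qed.

Lemma spectral_scalar {R : realType} {n : nat} (a : R) (x : 'cV[R]_n) :
  frobenius x = 1 -> spectral (a%:M : 'M[R]_n) = `|a|.
Proof.
by move=> x1; apply: (spectralE x1) => [|y y1];
  rewrite mul_scalar_mx frobeniusZ ?x1 ?y1 mulr1.
Qed.

(** * Distance to singularity of a matrix that is bounded below *)

Lemma normalized {R : realType} {n : nat} {x : 'cV[R]_n} :
  x != 0 -> frobenius ((frobenius x)^-1 *: x) = 1.
Proof.
move=> x0; rewrite frobeniusZ ger0_norm ?invr_ge0 ?frobenius_ge0 //.
by rewrite mulVf // frobenius_eq0.
Qed.

Lemma singularP {R : realType} {n : nat} (S : 'M[R]_n) :
  singular S <-> exists2 x : 'cV[R]_n, frobenius x = 1 & S *m x = 0.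
Proof.
split=> [|[x x1 Sx0]].
  rewrite /singular /= unitmxE unitfE negbK -det_tr => /det0P[v v0 vS].
  have x0 : v^T != 0 by rewrite -trmx0 (inj_eq trmx_inj).
  exists ((frobenius v^T)^-1 *: v^T); first exact: normalized.
  by rewrite -scalemxAr -[S in S *m _]trmxK -trmx_mul vS trmx0 scaler0.
apply/negP => uS; have /eqP[] := oner_neq0 R.
by rewrite -x1 -(mulKmx uS x) Sx0 mulmx0 frobenius0.
Qed.

(** A unit kernel vector of [S] is mapped by [A - S] to its image by [A]. *)
Lemma spectral_sub_singular_ge {R : realType} {n : nat} {A : 'M[R]_n} {m : R} :
  (forall x : 'cV[R]_n, frobenius x = 1 -> m <= frobenius (A *m x)) ->
  forall S, singular S -> m <= spectral (A - S).
Proof.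
move=> Am S /singularP[x x1 Sx0]; apply: le_trans (spectral_ge _ x x1).
by rewrite mulmxBl Sx0 subr0 Am.
Qed.

Lemma spectral_le_frobenius {R : realType} {n : nat} {A : 'M[R]_n} {x : 'cV[R]_n} :
  frobenius x = 1 -> spectral A <= frobenius A.
Proof.
move=> x1; apply: ge_sup => [|_ [y /= y1 <-]].
  by exists (frobenius (A *m x)), x.
by rewrite -[leRHS]mulr1 -y1; exact: frobenius_mulmx_le.
Qed.

Lemma singular_shift {R : realType} {n : nat} {A : 'M[R]_n} {l : R} {x : 'cV[R]_n} :
  unit_eigenvector A l x -> singular (A - l%:M).
Proof.
by case=> Ax x1; apply/singularP; exists x; rewrite // mulmxBl Ax mul_scalar_mx subrr.
Qed.

(** Shifting by the eigenvalue of least modulus reaches the lower bound, in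
    every class of singular matrices that contains the shifted matrix. *)
Lemma dist_spectral_shift {R : realType} {n : nat} {A : 'M[R]_n} {l : R}
    {x : 'cV[R]_n} {C : set 'M[R]_n} :
  (forall x : 'cV[R]_n, frobenius x = 1 -> `|l| <= frobenius (A *m x)) ->
  unit_eigenvector A l x -> C `<=` @singular R n -> C (A - l%:M) ->
  dist (@spectral R n) C A = `|l|.
Proof.
move=> Al [Ax x1] Csing Cshift; apply: minvalE => [|_ [S CS <-]].
  by exists (A - l%:M) => //; rewrite opprB addrC subrK (spectral_scalar _ x x1).
exact: spectral_sub_singular_ge Al _ (Csing _ CS).
Qed.

(** A nearest singular matrix in the Frobenius norm is the deflation of an
    eigenvector of least modulus: removing l x x^T costs |l| because x x^T has
    norm 1. *)
Lemma dF_deflation {R : realType} {n : nat} {A : 'M[R]_n} {l : R} {x : 'cV[R]_n} :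
  (forall x : 'cV[R]_n, frobenius x = 1 -> `|l| <= frobenius (A *m x)) ->
  unit_eigenvector A l x -> dF A = `|l|.
Proof.
move=> Al [Ax x1]; have xx : x^T *m x = 1%:M.
  by apply/matrixP => i j; rewrite !ord1 -frobenius_dot x1 expr1n mxE.
apply: minvalE => [|_ [S Ssing <-]]; last first.
  apply: le_trans (spectral_le_frobenius x1).
  exact: spectral_sub_singular_ge Al _ Ssing.
exists (A - l *: (x *m x^T)).
  apply/singularP; exists x => //.
  by rewrite mulmxBl Ax -scalemxAl -mulmxA xx mulmx1 subrr.
rewrite opprB addrC subrK frobeniusZ; suff -> : frobenius (x *m x^T) = 1 by rewrite mulr1.
apply/eqP; rewrite -(@eqrXn2 _ 2) ?frobenius_ge0 // frobenius_isometry //.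
by rewrite frobenius_tr trmxK mxtrace_mulC xx mxtrace1 expr1n.
Qed.

(** The lower bound, applied to the normalized solution z of A z = y, bounds
    the inverse by 1 / |l|; the eigenvector itself attains this. *)
Lemma spectral_invmx {R : realType} {n : nat} {A : 'M[R]_n} {l : R} {x : 'cV[R]_n} :
  (forall x : 'cV[R]_n, frobenius x = 1 -> `|l| <= frobenius (A *m x)) ->
  unit_eigenvector A l x -> A \in unitmx ->
  0 < `|l| /\ spectral (invmx A) = `|l|^-1.
Proof.
move=> Al [Ax x1] uA.
have l0 : l != 0.
  apply: contraTneq uA => l0; apply/singularP; exists x => //.
  by rewrite Ax l0 scale0r.
split; first by rewrite normr_gt0.
apply: (spectralE x1) => [|y y1].
  have -> : invmx A *m x = l^-1 *: x.
    by rewrite -[in LHS](scalerK l0 x) -Ax -scalemxAr mulKmx.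
  by rewrite frobeniusZ x1 mulr1 normfV.
set z := invmx A *m y; have z0 : z != 0.
  apply/eqP => z0; have /eqP[] := oner_neq0 R.
  by rewrite -y1 -(mulKVmx uA y) -/z z0 mulmx0 frobenius0.
have zp : 0 < frobenius z by rewrite lt_neqAle eq_sym frobenius_eq0 z0 frobenius_ge0.
have := Al _ (normalized z0).
rewrite -scalemxAr mulKVmx // frobeniusZ y1 mulr1.
rewrite [leRHS]ger0_norm ?invr_ge0 ?frobenius_ge0 //.
by move=> lz; rewrite -[leLHS]invrK lef_pV2 ?posrE ?normr_gt0 ?invr_gt0.
Qed.

(** * Diagonalization by the discrete sine vectors *)

Lemma tridiagE {R : realType} {n : nat} (d s : R) (i j : 'I_n) :
  tridiag n d s i j =
    d * (i == j :> nat)%:R + s * (i.+1 == j :> nat)%:R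
    + s * (j.+1 == i :> nat)%:R.
Proof.
rewrite mxE -val_eqE /=.
by do 3 (case: eqP => /= ?; try lia); ring.
Qed.

Lemma tridiagD {R : realType} {n : nat} (d s d' s' : R) :
  tridiag n (d + d') (s + s') = tridiag n d s + tridiag n d' s'.
Proof. by apply/matrixP => i j; rewrite !(tridiagE, mxE); ring. Qed.

Lemma tridiagZ {R : realType} {n : nat} (a d s : R) :
  tridiag n (a * d) (a * s) = a *: tridiag n d s.
Proof. by apply/matrixP => i j; rewrite !(tridiagE, mxE); ring. Qed.

Lemma tridiag_scalar {R : realType} {n : nat} (a : R) : tridiag n a 0 = a%:M.
Proof.
apply/matrixP => i j; rewrite tridiagE mxE -val_eqE /=.
by case: eqP => _; rewrite ?mulr1n ?mulr0n; ring.
Qed.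

Lemma tridiag_tr {R : realType} {n : nat} (d s : R) :
  (tridiag n d s)^T = tridiag n d s.
Proof.
apply/matrixP => i j; rewrite mxE !tridiagE.
by rewrite [val j == val i]eq_sym addrAC.
Qed.

Lemma sum_ord_eq {R : realType} {n : nat} (k : nat) (g : nat -> R) :
  \sum_(j < n) (k == j :> nat)%:R * g j = (k < n)%:R * g k.
Proof.
case: ltnP => [kn|nk].
  rewrite (bigD1 (Ordinal kn)) //= eqxx big1 ?addr0 // => j.
  by rewrite -val_eqE /= eq_sym => /negPf ->; rewrite mul0r.
rewrite mul0r big1 // => j _; case: eqP => [kj|_]; last by rewrite mul0r.
by have := ltn_ord j; rewrite -kj ltnNge nk.
Qed.

(** The two boundary conditions let the three-term formula hold also in the
    first and in the last row. *)
Lemma sum_tridiag {R : realType} {n : nat} (d s : R) (f : nat -> R) (i : 'I_n) :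
  f 0%N = 0 -> f n.+1 = 0 ->
  \sum_j tridiag n d s i j * f j.+1 = d * f i.+1 + s * (f i + f i.+2).
Proof.
move=> f0 fn.
have -> : \sum_j tridiag n d s i j * f j.+1 =
    d * (\sum_(j < n) (i == j :> nat)%:R * f j.+1)
    + s * (\sum_(j < n) (i.+1 == j :> nat)%:R * f j.+1)
    + s * (\sum_(j < n) (j.+1 == i :> nat)%:R * f j.+1).
  rewrite !mulr_sumr -!big_split /=; apply: eq_bigr => j _.
  by rewrite tridiagE; ring.
rewrite (sum_ord_eq i (fun j => f j.+1)) (sum_ord_eq i.+1 (fun j => f j.+1)).
have -> : \sum_(j < n) (j.+1 == i :> nat)%:R * f j.+1 = f i.
  case: i => [[|i] /= ilt].
    by rewrite f0 big1 // => j _; rewrite mul0r.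
  under eq_bigr do rewrite eqSS [_ == i]eq_sym.
  by rewrite (sum_ord_eq i (fun j => f j.+1)) ltnW // mul1r.
rewrite ltn_ord; have : (i.+1 < n)%:R * f i.+2 = f i.+2.
  case: ltnP => [_|ni]; first by rewrite mul1r.
  by have -> : i.+2 = n.+1 by [have := ltn_ord i; lia]; rewrite fn mulr0.
by move=> ->; rewrite mul1r; ring.
Qed.

Definition angle (R : realType) (n h : nat) : R := h%:R * pi / n.+1%:R.

Lemma angle_itv {R : realType} {n h : nat} :
  (h <= n.+1)%N -> angle R n h \in `[0, pi].
Proof.
move=> hn; have p0 := pi_gt0 R.
rewrite in_itv /= /angle !mulr_ge0 ?invr_ge0 ?pi_ge0 ?ler0n //=.
by rewrite ler_pdivrMr ?ltr0n // mulrC ler_wpM2l ?ler_nat // ltW.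
Qed.

Lemma angle_lt {R : realType} {n h l : nat} :
  (angle R n h < angle R n l) = (h < l)%N.
Proof.
by rewrite /angle ltr_pM2r ?invr_gt0 ?ltr0n // ltr_pM2r ?pi_gt0 // ltr_nat.
Qed.

Lemma cos_angle_lt {R : realType} {n h l : nat} :
  (h <= n.+1)%N -> (l <= n.+1)%N ->
  (cos (angle R n l) < cos (angle R n h)) = (h < l)%N.
Proof. by move=> hn ln; rewrite ltr_cos ?angle_itv // angle_lt. Qed.

Lemma sin_natpi {R : realType} (h : nat) : sin (h%:R * pi : R) = 0.
Proof.
elim: h => [|h IH]; first by rewrite mul0r sin0.
by rewrite -natr1 mulrDl mul1r sinD IH sinpi; ring.
Qed.

Definition sine_vector (R : realType) (n h : nat) : 'cV[R]_n :=
  \col_(i < n) sin (i.+1%:R * angle R n h).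

(** The three-term recurrence is the addition formula for sin, and the
    boundary terms vanish because sin does at 0 and at h pi. *)
Lemma tridiag_sine_vector {R : realType} {n : nat} (d s : R) (h : nat) :
  tridiag n d s *m sine_vector R n h = eigval n d s h *: sine_vector R n h.
Proof.
apply/matrixP => i j; rewrite {j}ord1 !mxE.
pose f k := sin (k%:R * angle R n h).
under eq_bigr do rewrite [sine_vector _ _ _ _ _]mxE -/(f _).
rewrite sum_tridiag; last 2 first.
- by rewrite /f mul0r sin0.
- by rewrite /f /angle mulrC divfK ?pnatr_eq0 // sin_natpi.
rewrite /f /eigval -/(angle R n h) -[in i.+2%:R]natr1.
have -> : (i%:R : R) = i.+1%:R - 1 by rewrite -natr1; ring.
by rewrite mulrBl mulrDl !mul1r sinB sinD; ring.
Qed.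

Lemma sine_vector_neq0 {R : realType} {n h : nat} :
  (0 < n)%N -> (1 <= h <= n)%N -> sine_vector R n h != 0.
Proof.
move=> n0 /andP[h0 hn]; apply/eqP => /matrixP /(_ (Ordinal n0) 0).
rewrite !mxE /= mul1r => /eqP; apply/negP; rewrite gt_eqF //.
apply: sin_gt0_pi; rewrite /angle divr_gt0 ?mulr_gt0 ?ltr0n ?pi_gt0 //=.
by rewrite ltr_pdivrMr ?ltr0n // mulrC ltr_pM2l ?pi_gt0 // ltr_nat ltnS.
Qed.

Definition unit_sine (R : realType) (n h : nat) : 'cV[R]_n :=
  (frobenius (sine_vector R n h))^-1 *: sine_vector R n h.

Lemma unit_sine_eigenvector {R : realType} {n h : nat} (d s : R) :
  (1 <= h <= n)%N -> unit_eigenvector (tridiag n d s) (eigval n d s h) (unit_sine R n h).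
Proof.
move=> hn; split.
  by rewrite /unit_sine -scalemxAr tridiag_sine_vector scalerA mulrC -scalerA.
by apply/normalized/sine_vector_neq0 => //; case/andP: hn; exact: leq_trans.
Qed.

(** Eigenvectors of the symmetric matrix [tridiag n 0 1] for distinct
    eigenvalues are orthogonal, which spares the evaluation of any
    trigonometric sum. *)
Lemma unit_sine_orthonormal {R : realType} {n h l : nat} :
  (1 <= h <= n)%N -> (1 <= l <= n)%N ->
  ((unit_sine R n h)^T *m unit_sine R n l) 0 0 = (h == l)%:R.
Proof.
move=> hn ln; have [Ah h1] := @unit_sine_eigenvector R n h 0 1 hn.
have [Al _] := @unit_sine_eigenvector R n l 0 1 ln.
have [<-|hl] := eqVneq h l; first by rewrite -frobenius_dot h1 expr1n.
set x := unit_sine R n h in Ah *; set y := unit_sine R n l in Al *.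
have /(congr1 (fun M : 'M[R]_1 => M 0 0)) :
    eigval n 0 1 h *: (x^T *m y) = eigval n 0 1 l *: (x^T *m y).
  transitivity (x^T *m tridiag n 0 1 *m y); last by rewrite -mulmxA Al -scalemxAr.
  by rewrite -[tridiag _ _ _]tridiag_tr -trmx_mul Ah [(_ *: x)^T]linearZ /= -scalemxAl.
rewrite mxE [in RHS]mxE => /eqP; rewrite -subr_eq0 -mulrBl mulf_eq0.
case/orP => /eqP // /eqP; rewrite subr_eq0 /eigval -/(angle R n h) -/(angle R n l).
rewrite !add0r => /eqP/(mulfI _); rewrite mulr1 pnatr_eq0 => /(_ isT) chl.
move: hl; rewrite neq_ltn.
rewrite -(@cos_angle_lt R n h l) -?(@cos_angle_lt R n l h) ?chl ?ltxx //; lia.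
Qed.

Definition sine_matrix (R : realType) (n : nat) : 'M[R]_n :=
  \matrix_(i, h) unit_sine R n h.+1 i 0.

Lemma sine_matrix_orthogonal {R : realType} {n : nat} :
  (sine_matrix R n)^T *m sine_matrix R n = 1%:M.
Proof.
apply/matrixP => h l; rewrite !mxE.
transitivity (((unit_sine R n h.+1)^T *m unit_sine R n l.+1) 0 0).
  by rewrite mxE; apply: eq_bigr => i _; rewrite !mxE.
by rewrite unit_sine_orthonormal ?ltn_ord //= eqSS.
Qed.

(** In the coordinates y of x along the sine vectors, the square norm of the
    image is the sum of the squares of eigenvalue times coordinate. *)
Lemma tridiag_ge {R : realType} {n : nat} {d s m : R} :
  (forall h, (1 <= h <= n)%N -> m <= `|eigval n d s h|) -> 0 <= m ->
  forall x : 'cV[R]_n, frobenius x = 1 -> m <= frobenius (tridiag n d s *m x).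
Proof.
move=> mle m0 x x1; set U := sine_matrix R n.
have UU : U^T *m U = 1%:M := sine_matrix_orthogonal.
pose y := U^T *m x; have Uy : U *m y = x by rewrite mulmxA (mulmx1C UU) mul1mx.
pose D := diag_mx (\row_(h < n) eigval n d s h.+1).
have TU : tridiag n d s *m U = U *m D.
  apply/matrixP => i h; rewrite mul_mx_diag !mxE.
  have [/matrixP/(_ i 0)] := @unit_sine_eigenvector R n h.+1 d s (ltn_ord h).
  by rewrite !mxE mulrC => <- _; apply: eq_bigr => j _; rewrite [U _ _]mxE.
rewrite -Uy mulmxA TU -mulmxA frobenius_isometry //.
rewrite -(@ler_pXn2r _ 2) ?nnegrE ?frobenius_ge0 //.
rewrite -[leLHS]mulr1 -[X in _ * X](expr1n _ 2) -x1 -Uy frobenius_isometry //.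
rewrite !frobenius_sqr mulr_sumr; apply: ler_sum => h _.
rewrite !big_ord1 mul_diag_mx !mxE exprMn ler_wpM2r ?sqr_ge0 //.
rewrite -[leRHS]real_normK ?num_real // ler_pXn2r ?nnegrE ?normr_ge0 //.
by apply: mle; exact: ltn_ord.
Qed.

(** * Structured condition number of an eigenvalue *)

Lemma frobenius_tridiag {R : realType} {n : nat} (d s : R) :
  frobenius (tridiag n d s) ^+ 2 = n%:R * d ^+ 2 + 2 * n.-1%:R * s ^+ 2.
Proof.
case: n => [|n].
  by rewrite frobenius_sqr big_ord0 !(mulr0n, mulr0, mul0r) addr0.
have off : \sum_(i < n.+1) \sum_(j < n.+1) (i.+1 == j :> nat)%:R = n%:R :> R.
  transitivity (\sum_(i < n.+1) (i.+1 < n.+1)%:R : R).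
    apply: eq_bigr => i _; under eq_bigr do rewrite -[_%:R]mulr1.
    by rewrite (sum_ord_eq i.+1 (fun=> 1)) mulr1.
  rewrite big_ord_recr /= ltnn addr0 -[in RHS](card_ord n) -sumr_const.
  by apply: eq_bigr => i _; rewrite ltnS ltn_ord.
have diag : \sum_(i < n.+1) \sum_(j < n.+1) (i == j :> nat)%:R = n.+1%:R :> R.
  rewrite -[in RHS](card_ord n.+1) -sumr_const; apply: eq_bigr => i _.
  under eq_bigr do rewrite -[_%:R]mulr1.
  by rewrite (sum_ord_eq i (fun=> 1)) ltn_ord mulr1.
transitivity (d ^+ 2 * (\sum_(i < n.+1) \sum_(j < n.+1) (i == j :> nat)%:R)
    + s ^+ 2 * (\sum_(i < n.+1) \sum_(j < n.+1) (i.+1 == j :> nat)%:R)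
    + s ^+ 2 * (\sum_(i < n.+1) \sum_(j < n.+1) (j.+1 == i :> nat)%:R)); last first.
  by rewrite [X in _ + _ + _ * X]exchange_big /= !off diag; ring.
rewrite frobenius_sqr !mulr_sumr -!big_split; apply: eq_bigr => i _.
rewrite !mulr_sumr -!big_split; apply: eq_bigr => j _ /=.
rewrite tridiagE.
by do 3 (case: eqP => /= ?; try lia); ring.
Qed.

Definition kappa_sqr (R : realType) (n h : nat) : R :=
  n%:R^-1 + 2 / n.-1%:R * cos (angle R n h) ^+ 2.

(** The Riesz representative, for the Frobenius inner product on tridiagonal
    Toeplitz matrices, of the linear form that sends such a matrix to its
    eigenvalue of index [h]. *)
Definition eigval_gradient (R : realType) (n h : nat) : 'M[R]_n :=
  tridiag n n%:R^-1 (cos (angle R n h) / n.-1%:R).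

Lemma kappa_sqr_gt0 {R : realType} {n h : nat} : (1 < n)%N -> 0 < kappa_sqr R n h.
Proof.
move=> n1; rewrite ltr_pwDl ?invr_gt0 ?ltr0n 1?ltnW //.
by rewrite mulr_ge0 ?sqr_ge0 // divr_ge0 ?ler0n.
Qed.

Lemma eigval_gradient_eigval {R : realType} {n h : nat} :
  eigval n n%:R^-1 (cos (angle R n h) / n.-1%:R) h = kappa_sqr R n h.
Proof. by rewrite /eigval -/(angle R n h) /kappa_sqr; ring. Qed.

Lemma frobenius_gradient {R : realType} {n h : nat} : (1 < n)%N ->
  frobenius (eigval_gradient R n h) = Num.sqrt (kappa_sqr R n h).
Proof.
move=> n1; have k0 := @kappa_sqr_gt0 R n h n1.
apply/eqP; rewrite -(@eqrXn2 _ 2) ?frobenius_ge0 ?sqrtr_ge0 //.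
rewrite frobenius_tridiag sqr_sqrtr ?(ltW k0) // /kappa_sqr; apply/eqP.
by field; rewrite !pnatr_eq0; lia.
Qed.

(** Cauchy--Schwarz inequality between the matrix and [eigval_gradient]. *)
Lemma eigval_le_frobenius {R : realType} {n h : nat} (d s : R) : (1 < n)%N ->
  `|eigval n d s h| <= Num.sqrt (kappa_sqr R n h) * frobenius (tridiag n d s).
Proof.
move=> n1; have k0 := @kappa_sqr_gt0 R n h n1.
rewrite -(@ler_pXn2r _ 2) ?nnegrE ?mulr_ge0 ?frobenius_ge0 ?sqrtr_ge0 //.
rewrite real_normK ?num_real // exprMn sqr_sqrtr ?(ltW k0) // frobenius_tridiag.
rewrite /eigval -/(angle R n h) /kappa_sqr; set c := cos _.
have n0 : 0 < n%:R :> R by rewrite ltr0n; lia.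
have m0 : 0 < n.-1%:R :> R by rewrite ltr0n; lia.
rewrite -subr_ge0; set p : R := n%:R in n0 *; set q : R := n.-1%:R in m0 *.
have -> : (p^-1 + 2 / q * c ^+ 2) * (p * d ^+ 2 + 2 * q * s ^+ 2)
    - (d + 2 * s * c) ^+ 2 = 2 / (p * q) * (p * c * d - q * s) ^+ 2.
  by field; rewrite !gt_eqF.
by rewrite mulr_ge0 ?sqr_ge0 // divr_ge0 // ltW // mulr_gt0.
Qed.

(** All matrices of the family are affine functions of any nondiagonal one. *)
Lemma tridiag_common_eigenvector {R : realType} {n k : nat} {d s : R} {x : 'cV[R]_n} :
  s != 0 -> unit_eigenvector (tridiag n d s) (eigval n d s k) x ->
  forall d' s', unit_eigenvector (tridiag n d' s') (eigval n d' s' k) x.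
Proof.
move=> s0 [Tx x1] d' s'; split=> //.
have -> : tridiag n d' s' = (d' - s' / s * d)%:M + (s' / s) *: tridiag n d s.
  rewrite -tridiagZ -tridiag_scalar -tridiagD; congr tridiag; first by ring.
  by field.
rewrite mulmxDl mul_scalar_mx -scalemxAl Tx scalerA -scalerDl.
by congr (_ *: _); rewrite /eigval; field.
Qed.

Lemma quadform_eigenvector {R : realType} {n : nat} {A : 'M[R]_n} {l : R} {x : 'cV[R]_n} :
  unit_eigenvector A l x -> quadform A x = l.
Proof.
case=> Ax x1; rewrite /quadform -mulmxA Ax -scalemxAr mxE -frobenius_dot x1.
by rewrite expr1n mulr1.
Qed.

(** On an eigenvector the quadratic form is the eigenvalue, a linear form
    bounded by Cauchy--Schwarz; the normalized gradient attains the bound. *)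
Lemma kappaTE {R : realType} {n k : nat} {d s : R} {x : 'cV[R]_n} :
  (1 < n)%N -> s != 0 -> unit_eigenvector (tridiag n d s) (eigval n d s k) x ->
  kappaT x = Num.sqrt (kappa_sqr R n k).
Proof.
move=> n1 s0 /(tridiag_common_eigenvector s0) Ex.
have k0 := @kappa_sqr_gt0 R n k n1.
apply: maxvalE => [|_ [E [[d' [s' ->]] /= E1] <-]]; last first.
  rewrite (quadform_eigenvector (Ex d' s')) -[leRHS]mulr1 -E1.
  exact: eigval_le_frobenius.
set r := Num.sqrt _; have r0 : 0 < r by rewrite sqrtr_gt0.
exists (r^-1 *: eigval_gradient R n k); first split.
- by rewrite -tridiagZ; eexists; eexists.
- by rewrite /= frobeniusZ frobenius_gradient // -/r gtr0_norm ?invr_gt0 // mulVf ?gt_eqF.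
- rewrite /quadform -scalemxAr -scalemxAl mxE -/(quadform _ _).
  rewrite (quadform_eigenvector (Ex _ _)) eigval_gradient_eigval.
  rewrite -[kappa_sqr _ _ _]sqr_sqrtr ?(ltW k0) // -/r expr2 mulKf ?gt_eqF //.
  by rewrite gtr0_norm.
Qed.

(** * The eigenvalues of definite members of the family *)

Lemma cos_angle_rev {R : realType} {n : nat} :
  cos (angle R n n) = - cos (angle R n 1).
Proof.
have -> : angle R n n = pi - angle R n 1.
  by rewrite /angle -natr1; field; rewrite natr1 pnatr_eq0.
by rewrite cosB cospi sinpi; ring.
Qed.

Lemma kappa_sqr_le {R : realType} {n h : nat} :
  (1 <= h <= n)%N -> kappa_sqr R n h <= kappa_sqr R n 1.
Proof.
move=> hn; rewrite lerD2l ler_wpM2l ?mulr_ge0 ?invr_ge0 ?ler0n //.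
have c1 : cos (angle R n h) <= cos (angle R n 1).
  by rewrite leNgt cos_angle_lt -?leqNgt; lia.
have cn : - cos (angle R n 1) <= cos (angle R n h).
  by rewrite -cos_angle_rev leNgt cos_angle_lt -?leqNgt; lia.
by rewrite -subr_ge0 subr_sqr mulr_ge0; lra.
Qed.

Lemma kappa_sqr_last {R : realType} {n : nat} : kappa_sqr R n n = kappa_sqr R n 1.
Proof. by rewrite /kappa_sqr cos_angle_rev sqrrN. Qed.

(** From n = 4 on the bound 1 on the cosine suffices; for n = 3 the exact
    value of the cosine of pi / 4 is needed. *)
Lemma kappa_sqr_lt1 {R : realType} {n : nat} : (2 < n)%N -> kappa_sqr R n 1 < 1.
Proof.
rewrite leq_eqVlt => /predU1P[<-|n3].
  have : cos (angle R 3 1 *+ 2) = 0.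
    by rewrite -[RHS](@cos_pihalf R) /angle; congr cos; field.
  by rewrite cos_mulr2n /kappa_sqr; set c := cos _ => /= ?; lra.
have c1 : cos (angle R n 1) ^+ 2 <= 1.
  by rewrite -[leRHS](@cos2Dsin2 R (angle R n 1)) lerDl sqr_ge0.
have a : n%:R^-1 <= 4^-1 :> R by rewrite lef_pV2 ?posrE ?ltr0n ?ler_nat //; lia.
have b : 0 <= (n.-1%:R^-1 : R) <= 3^-1.
  by rewrite invr_ge0 ler0n lef_pV2 ?posrE ?ltr0n ?ler_nat //; lia.
have : n.-1%:R^-1 * cos (angle R n 1) ^+ 2 <= n.-1%:R^-1.
  by rewrite ler_piMr //; case/andP: b.
by rewrite /kappa_sqr -mulrA; lra.
Qed.

Lemma definite_eigval {R : realType} {n : nat} {d s : R} :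
  posdef (tridiag n d s) \/ negdef (tridiag n d s) ->
  (forall h, (1 <= h <= n)%N -> 0 < eigval n d s h) \/
  (forall h, (1 <= h <= n)%N -> eigval n d s h < 0).
Proof.
case=> def; [left|right] => h /(@unit_sine_eigenvector R _ _ d s) Ex;
  rewrite -(quadform_eigenvector Ex); apply: def; case: Ex => _ x1;
  by rewrite -frobenius_eq0 x1 oner_neq0.
Qed.

Lemma definite_unit {R : realType} {n : nat} {A : 'M[R]_n} :
  posdef A \/ negdef A -> A \in unitmx.
Proof.
move=> def; apply: contrapT => /negP/singularP[x x1 Ax0].
have x0 : x != 0 by rewrite -frobenius_eq0 x1 oner_neq0.
have q0 : quadform A x = 0 by rewrite /quadform -mulmxA Ax0 mulmx0 mxE.
by case: def => /(_ x x0); rewrite q0 ltxx.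
Qed.

(** The eigenvalues are strictly monotone in the index, so that an interior one
    lies strictly between the first and the last, hence, when all have the
    same sign, is not of least modulus. *)
Lemma definite_smallest {R : realType} {n k : nat} {d s : R} :
  s != 0 -> posdef (tridiag n d s) \/ negdef (tridiag n d s) ->
  (1 <= k <= n)%N ->
  (forall h, (1 <= h <= n)%N -> `|eigval n d s k| <= `|eigval n d s h|) ->
  k = 1%N \/ k = n.
Proof.
move=> s0 def kn kmin; apply: contrapT => /not_orP[k1 kNn].
(* e is the common sign of the eigenvalues. *)
have [e e0 normE] : exists2 e : R, e != 0 &
    forall h, (1 <= h <= n)%N -> `|eigval n d s h| = e * eigval n d s h.
  case: (definite_eigval def) => sg; [exists 1 | exists (-1)];
    rewrite ?oppr_eq0 ?oner_neq0 // => h /sg eh.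
  - by rewrite mul1r gtr0_norm.
  - by rewrite mulN1r ltr0_norm.
have side h : (1 <= h <= n)%N ->
    0 <= e * s * (cos (angle R n h) - cos (angle R n k)).
  move=> hn; have := kmin h hn; rewrite !normE // -subr_ge0.
  have -> : e * eigval n d s h - e * eigval n d s k =
      2 * (e * s * (cos (angle R n h) - cos (angle R n k))).
    by rewrite /eigval -!/(angle _ _ _); ring.
  by rewrite pmulr_rge0.
have /eqP[] : e * s != 0 by rewrite mulf_neq0.
apply/le_anti/andP; split.
  have := side n; rewrite nmulr_lge0; first by apply; lia.
  by rewrite subr_lt0 cos_angle_lt; lia.
have := side 1%N; rewrite pmulr_lge0; first by apply; lia.
by rewrite subr_gt0 cos_angle_lt; lia.
Qed.

Lemma ex_smallest {R : realType} {n : nat} (d s : R) : (0 < n)%N ->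
  exists2 k, (1 <= k <= n)%N &
    forall h, (1 <= h <= n)%N -> `|eigval n d s k| <= `|eigval n d s h|.
Proof.
case: n => // n _.
pose f (i : 'I_n.+1) := `|eigval n.+1 d s i.+1|.
case: (@arg_minP _ R _ (@ord0 n) xpredT f) => // k _ kmin.
exists k.+1 => [|[|h] //= hn]; first exact: ltn_ord.
exact: kmin (Ordinal hn) isT.
Qed.

(** * Distances to singularity within the family *)

Lemma frobeniusN {R : realType} {m n : nat} (A : 'M[R]_(m, n)) :
  frobenius (- A) = frobenius A.
Proof. by rewrite -scaleN1r frobeniusZ normrN1 mul1r. Qed.

Lemma spectralN {R : realType} {n : nat} (A : 'M[R]_n) :
  spectral (- A) = spectral A.
Proof.
by congr sup; apply: eq_imagel => x _; rewrite mulNmx frobeniusN.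
Qed.

Lemma tridiagB {R : realType} {n : nat} (d s d' s' : R) :
  tridiag n d s - tridiag n d' s' = tridiag n (d - d') (s - s').
Proof. by rewrite -scaleN1r -tridiagZ -tridiagD !mulN1r. Qed.

Lemma tridiag_shift_toeplitz {R : realType} {n : nat} (d s l : R) :
  @toeplitz3 R n (tridiag n d s - l%:M).
Proof. by exists (d - l), s; rewrite -tridiag_scalar tridiagB subr0. Qed.

Lemma tridiag_singular_eigval {R : realType} {n : nat} {d s : R} : (0 < n)%N ->
  singular (tridiag n d s) -> exists2 h, (1 <= h <= n)%N & eigval n d s h = 0.
Proof.
move=> n0 /singularP[x x1 Tx0]; have [k kn kmin] := ex_smallest d s n0.
exists k => //; apply/eqP; rewrite -normr_le0.
by have := tridiag_ge kmin (normr_ge0 _) x x1; rewrite Tx0 frobenius0.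
Qed.

(** To be singular a member of the family must annihilate some eigenvalue of
    index [h], at a cost of at least the modulus of that eigenvalue over its
    condition number. The index [k] with least modulus and greatest condition
    number is the cheapest, and moving along [eigval_gradient] attains its
    cost. *)
Lemma dFT_eigval {R : realType} {n k : nat} {d s : R} : (1 < n)%N ->
  (1 <= k <= n)%N ->
  (forall h, (1 <= h <= n)%N -> `|eigval n d s k| <= `|eigval n d s h|) ->
  (forall h, (1 <= h <= n)%N -> kappa_sqr R n h <= kappa_sqr R n k) ->
  dFT (tridiag n d s) = `|eigval n d s k| / Num.sqrt (kappa_sqr R n k).
Proof.
move=> n1 kn kmin kmax; have K0 := @kappa_sqr_gt0 R n k n1.
set l := eigval n d s k in kmin *; set K := kappa_sqr R n k in kmax K0 *.
have eigvalB a b h :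
    eigval n (d - a) (s - b) h = eigval n d s h - eigval n a b h.
  by rewrite /eigval; ring.
apply: minvalE => [|_ [S [Ssing [a [b SE]]] <-]]; last first.
  rewrite SE in Ssing *.
  have [h hn Sh0] := tridiag_singular_eigval (ltnW n1) Ssing.
  rewrite tridiagB ler_pdivrMr ?sqrtr_gt0 // mulrC.
  apply: le_trans (kmin h hn) _; rewrite -[eigval n d s h]subr0 -Sh0 -eigvalB.
  apply: le_trans (eigval_le_frobenius _ _ n1) _.
  by rewrite ler_wpM2r ?frobenius_ge0 // ler_wsqrtr // kmax.
exists (tridiag n (d - l / K * n%:R^-1) (s - l / K * (cos (angle R n k) / n.-1%:R))).
  split; last by eexists; eexists.
  have [Sx x1] := @unit_sine_eigenvector R n k (d - l / K * n%:R^-1)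
    (s - l / K * (cos (angle R n k) / n.-1%:R)) kn.
  apply/singularP; exists (unit_sine R n k) => //; rewrite Sx eigvalB.
  suff -> : eigval n (l / K * n%:R^-1) (l / K * (cos (angle R n k) / n.-1%:R)) k = l.
    by rewrite subrr scale0r.
  transitivity (l / K * K); last by rewrite divfK ?gt_eqF.
  by rewrite {4}/K -eigval_gradient_eigval /eigval; ring.
rewrite tridiagB !subKr tridiagZ -/(eigval_gradient R n k) frobeniusZ.
rewrite frobenius_gradient // -/K normrM normfV (gtr0_norm K0) -mulrA; congr (_ * _).
rewrite -[X in X^-1 * _](sqr_sqrtr (ltW K0)) expr2 invfM -mulrA.
by rewrite mulVf ?mulr1 // gt_eqF ?sqrtr_gt0.
Qed.

(* For nonsingular T the equality d2T T = 1 / spectral (invmx T) needs no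
   definiteness: if l is an eigenvalue of smallest magnitude, T - l I is
   tridiagonal Toeplitz and singular, at spectral distance `|l|.  The first
   conjunct states this; its converse "equality implies definite" is false,
   e.g. for n = 2, delta = 0, sigma = 1.  For n = 2 one has
   dFT T = dF T, so strictness is claimed for n > 2. *)
Theorem mainTheorem6 (R : realType) (n : nat) (delta sigma : R) :
  (1 < n)%N -> sigma != 0 ->
  let T := tridiag n delta sigma in
  let lambda := eigval n delta sigma in
  (T \in unitmx -> d2T T = 1 / spectral (invmx T)) /\
  (posdef T \/ negdef T ->
   [/\ T \in unitmx,
       d2T T = 1 / spectral (invmx T),
       forall (k : nat) (x : 'cV[R]_n),
         (1 <= k <= n)%N ->
         (forall h : nat, (1 <= h <= n)%N -> `|lambda k| <= `|lambda h|) ->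
         unit_eigenvector T (lambda k) x ->
         (k = 1%N \/ k = n) /\
         [/\ d2 T = d2T T, d2T T = `|lambda k|, `|lambda k| = dF T,
             (2 < n)%N -> dF T < dFT T
           & dFT T = `|lambda k| / kappaT x]
     & 1 / cond2 T =
       minval [set spectral E / spectral T |
                 E in @toeplitz3 R n `&` [set E | singular (T + E)]]]).
Proof.
move=> n1 s0 T lambda.
have Tge k : (forall h, (1 <= h <= n)%N -> `|lambda k| <= `|lambda h|) ->
    forall x : 'cV[R]_n, frobenius x = 1 -> `|lambda k| <= frobenius (T *m x).
  by move=> kmin; exact: tridiag_ge kmin (normr_ge0 _).
have d2TE k x : (forall h, (1 <= h <= n)%N -> `|lambda k| <= `|lambda h|) ->
    unit_eigenvector T (lambda k) x -> d2T T = `|lambda k|.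
  move=> kmin Tx; apply: (dist_spectral_shift (Tge k kmin) Tx) => [S []//|].
  by split; [exact: singular_shift Tx | exact: tridiag_shift_toeplitz].
have [k0 k0n k0min] := ex_smallest delta sigma (ltnW n1).
have Tx0 := @unit_sine_eigenvector R n k0 delta sigma k0n.
have d2T_inv : T \in unitmx -> d2T T = 1 / spectral (invmx T).
  move=> uT; have [_ ->] := spectral_invmx (Tge k0 k0min) Tx0 uT.
  by rewrite div1r invrK; exact: d2TE Tx0.
split=> // def; have uT := definite_unit def; split => //; first exact: d2T_inv.
- move=> k x kn kmin Tx; have kE := definite_smallest s0 def kn kmin.
  have KE : kappa_sqr R n k = kappa_sqr R n 1.
    by case: kE => ->; rewrite ?kappa_sqr_last.
  have [l0 _] := spectral_invmx (Tge k kmin) Tx uT.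
  have dFE := dF_deflation (Tge k kmin) Tx.
  have dFTE : dFT T = `|lambda k| / Num.sqrt (kappa_sqr R n k).
    by apply: dFT_eigval => // h hn; rewrite KE; exact: kappa_sqr_le.
  split=> //; rewrite (d2TE k x kmin Tx) (kappaTE n1 s0 Tx); split => //.
    apply: (dist_spectral_shift (Tge k kmin) Tx) => //.
    exact: singular_shift Tx.
  move=> n2; rewrite dFE dFTE ltr_pdivlMr ?sqrtr_gt0 ?kappa_sqr_gt0 //.
  by rewrite gtr_pMr // -sqrtr1 ltr_sqrt // KE kappa_sqr_lt1.
- have [l0 invE] := spectral_invmx (Tge k0 k0min) Tx0 uT.
  have [Ax x1] := Tx0.
  have T0 : 0 < spectral T.
    apply: lt_le_trans l0 _; apply: le_trans (Tge k0 k0min _ x1) _.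
    exact: spectral_ge.
  rewrite /cond2 invE div1r invfM invrK mulrC; apply/esym/minvalE.
    exists (- (lambda k0)%:M); last by rewrite spectralN (spectral_scalar _ _ x1).
    split; last exact: singular_shift Tx0.
    by exists (- lambda k0), 0; rewrite tridiag_scalar raddfN.
  move=> _ [E [_ Esing] <-]; rewrite ler_pM2r ?invr_gt0 //.
  have := spectral_sub_singular_ge (Tge k0 k0min) _ Esing.
  by rewrite opprD addNKr spectralN.
Qed.
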